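(* Let $(\mathfrak{B},G,\beta)$ be a $C^*$-dynamical system with $\mathfrak{B}$ unital and $G$ compact abelian, and let $u:\widehat{G}\times\widehat{G}\to\mathbb{T}$ be a bicharacter. Let $(\mathfrak{A}_n,\iota_n)_{n\in\mathbb{N}}$ be the inductive sequence $\mathfrak{A}_0:=\mathfrak{B}$, $\mathfrak{A}_{n+1}:=\mathfrak{A}_n\circledast_u\mathfrak{B}$, $\iota_n(a)=a\circledast 1$, with the actions $\alpha^{(0)}:=\beta$, $\alpha^{(n+1)}_g:=\alpha^{(n)}_g\circledast_u\beta_g$ of $G$, and let $\mathfrak{A}$ be its $C^*$-inductive limit, with canonical embeddings $j_n:\mathfrak{A}_n\to\mathfrak{A}$. Then the compatible sequence of actions $(\alpha^{(n)})_n$ determines a $C^*$-dynamical system $(\mathfrak{A},G,\alpha)$, i.e. a pointwise norm-continuous action $\alpha$ of $G$ on $\mathfrak{A}$ with $\alpha_g\circ j_n=j_n\circ\alpha^{(n)}_g$ for all $g\in G$, $n\in\mathbb{N}$. In addition, any sequence of invariant states $(\varphi_n)_{n\in\mathbb{N}}\subset\mathcal{S}_G(\mathfrak{B})$ determines an $\alpha$-invariant state $\omega\in\mathcal{S}_G(\mathfrak{A})$ (the infinite product state) through its compatible sequence of partial product states $\omega_0:=\varphi_0$, $\omega_{n+1}:=\omega_n\times\varphi_{n+1}$ on $\mathfrak{A}_{n+1}$, i.e. $\omega\circ j_n=\omega_n$ for all $n\in\mathbb{N}$.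
   Context: Gradings. For a pointwise norm-continuous action $\alpha$ of a compact abelian group $G$ on a unital $C^*$-algebra $\mathfrak{C}$, put $\mathfrak{C}_\sigma=\{c:\alpha_g(c)=\chi_\sigma(g)c\ \forall g\in G\}$, $\sigma\in\widehat{G}$ (homogeneous elements of degree $\partial c=\sigma$; $\chi_\sigma$ is the character $\sigma$; $\widehat G$ is discrete, written additively) and $\mathfrak{C}_o$ the algebraic direct sum of the $\mathfrak{C}_\sigma$, a dense $*$-subalgebra. $\mathcal{S}_G(\mathfrak{C})$ is the set of $G$-invariant states of $\mathfrak{C}$. A bicharacter $u:\widehat{G}\times\widehat{G}\to\mathbb{T}$ is a map that is a character in each variable. Twisted tensor product. For $G$-systems $\mathfrak{C},\mathfrak{D}$, $\mathfrak{C}_o\odot\mathfrak{D}_o$ is an involutive algebra with, on homogeneous elements, $(c\odot d)(C\odot D)=\overline{u(\partial C,\partial d)}\,cC\odot dD$, $(c\odot d)^*=\overline{u(\partial c,\partial d)}\,c^*\odot d^*$. For $G$-invariant states $\omega,\varphi$ of $\mathfrak{C},\mathfrak{D}$ the functional $(\omega\times\varphi)(c\odot d)=\omega(c)\varphi(d)$ is positive with GNS representation by bounded operators; $\mathfrak{C}\circledast_u\mathfrak{D}$ is the completion for the $C^*$-norm $\|x\|_{\min}=\sup_{\omega,\varphi}\|\pi_{\omega\times\varphi}(x)\|$ (sup over pairs of $G$-invariant states), to which each $\omega\times\varphi$ extends as a state. If $\alpha,\delta$ are the actions on $\mathfrak{C},\mathfrak{D}$, then $\alpha_g\circledast_u\delta_g$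 is the automorphism of $\mathfrak{C}\circledast_u\mathfrak{D}$ extending $c\odot d\mapsto\alpha_g(c)\odot\delta_g(d)$ (diagonal action). The map $c\mapsto c\circledast1$ extends to an injective $*$-homomorphism $\mathfrak{C}\to\mathfrak{C}\circledast_u\mathfrak{D}$. *)

(* Defs.v *)
From HB Require Import structures.
From mathcomp Require Import all_boot all_order all_algebra.
From mathcomp Require Import complex.
From mathcomp Require Import all_classical all_reals all_analysis.

Set Implicit Arguments.
Unset Strict Implicit.
Unset Printing Implicit Defensive.

Import Order.TTheory GRing.Theory Num.Theory.
Import numFieldNormedType.Exports.

Local Open Scope classical_set_scope.
Local Open Scope ring_scope.
Local Open Scope complex_scope.

(* Unital (non-zero) C*-algebras over R[i].  The product is not taken from
   GRing.Algebra: joining GRing.Algebra with NormedModule is rejected by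
   Hierarchy Builder, for lack of a common join with Num.NumDomain.
   The norm takes its (real) values in R[i]. *)
HB.mixin Record isCStar (R : realType) A of CompleteNormedModule R[i] A := {
  cmul : A -> A -> A;
  cone : A;
  star : A -> A;
  cmulA : associative cmul;
  cmul1l : left_id cone cmul;
  cmul1r : right_id cone cmul;
  cmulDl : left_distributive cmul +%R;
  cmulDr : right_distributive cmul +%R;
  cmulZl : forall (k : R[i]) (x y : A), cmul (k *: x) y = k *: cmul x y;
  cmulZr : forall (k : R[i]) (x y : A), cmul x (k *: y) = k *: cmul x y;
  cone_neq0 : cone != 0;
  starD : {morph star : x y / x + y};
  starZ : forall (k : R[i]) (x : A), star (k *: x) = k^* *: star x;
  starM : forall x y : A, star (cmul x y) = cmul (star y) (star x);
  starK : involutive star;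
  cnormM : forall x y : A, `|cmul x y| <= `|x| * `|y|;
  cstar_id : forall x : A, `|cmul (star x) x| = `|x| ^+ 2 }.

#[short(type="cstarType")]
HB.structure Definition CStar (R : realType) :=
  {A of CompleteNormedModule R[i] A & isCStar R A}.

Local Notation "x ** y" := (cmul x y) (at level 40, left associativity).

Section Morphisms.
Variables (R : realType) (A B : cstarType R).

Definition is_starhom (f : A -> B) : Prop :=
  [/\ linear f, f cone = cone, forall x y, f (x ** y) = f x ** f y
    & forall x, f (star x) = star (f x)].

Definition is_state (w : A -> R[i]) : Prop :=
  [/\ scalar w, forall x, 0 <= w (star x ** x) & w cone = 1].

End Morphisms.

(* G is written additively. *)
Section Dual.
Variables (R : realType) (G : topologicalZmodType).

Definition is_character (s : G -> R[i]) : Prop :=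
  [/\ continuous (s : G -> R[i]^o), forall g h, s (g + h) = s g * s h & forall g, `|s g| = 1].

Record dual := Dual { char_of :> G -> R[i]; char_ofP : is_character char_of }.

HB.instance Definition _ := gen_eqMixin dual.
HB.instance Definition _ := gen_choiceMixin dual.

Lemma dual_eq (s t : dual) : s =1 t -> s = t.
Proof.
case: s t => [s sP] [t tP] /= /funext st.
by case: t / st tP => tP; rewrite (Prop_irrelevance sP tP).
Qed.

Lemma is_character1 : is_character (fun=> 1).
Proof.
by split=> [|g h|g]; [exact: cst_continuous|rewrite mulr1|rewrite normr1].
Qed.

Lemma is_characterM (s t : dual) : is_character (fun g => s g * t g).
Proof.
have [sc sM s1] := char_ofP s; have [tc tM t1] := char_ofP t.
split=> [g|g h|g]; first exact: cvgM (sc g) (tc g).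
  by rewrite sM tM mulrACA.
by rewrite normrM s1 t1 mulr1.
Qed.

Lemma is_characterN (s : dual) : is_character (fun g => s (- g)).
Proof.
have [sc sM s1] := char_ofP s; split=> [g|g h|g].
- by apply: (@continuous_comp G G R[i]^o -%R s);
    [exact: opp_continuous|exact: sc].
- by rewrite opprD sM.
- by rewrite s1.
Qed.

(* The dual group, written additively: (s + t) g = s g * t g. *)
Definition dual0 := Dual is_character1.
Definition dualD (s t : dual) := Dual (is_characterM s t).
Definition dualN (s : dual) := Dual (is_characterN s).

Lemma dualDA : associative dualD.
Proof. by move=> s t v; apply: dual_eq => g /=; rewrite mulrA. Qed.

Lemma dualDC : commutative dualD.
Proof. by move=> s t; apply: dual_eq => g /=; rewrite mulrC. Qed.

Lemma dualD0 : left_id dual0 dualD.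
Proof. by move=> s; apply: dual_eq => g /=; rewrite mul1r. Qed.

Lemma dualDN : left_inverse dual0 dualN dualD.
Proof.
move=> s; apply: dual_eq => g /=.
have [_ sM s1] := char_ofP s.
rewrite -sM addNr; apply: (@mulfI _ (s 0)); last by rewrite -sM addr0 mulr1.
by rewrite -normr_eq0 s1 oner_eq0.
Qed.

HB.instance Definition _ :=
  GRing.isZmodule.Build dual dualDA dualDC dualD0 dualDN.

Definition is_bicharacter (u : dual -> dual -> R[i]) : Prop :=
  [/\ forall s t, `|u s t| = 1,
      forall s s' t, u (s + s') t = u s t * u s' t
    & forall s t t', u s (t + t') = u s t * u s t'].

End Dual.
Arguments dual R G : clear implicits.

Section Actions.
Variables (R : realType) (G : topologicalZmodType) (C : cstarType R).
Implicit Type alpha : G -> C -> C.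

(* Each [alpha g] is then bijective, with inverse [alpha (- g)]. *)
Definition is_cstar_action alpha : Prop :=
  [/\ forall g, is_starhom (alpha g), forall x, alpha 0 x = x,
      forall g h x, alpha (g + h) x = alpha g (alpha h x)
    & forall x, continuous (fun g => alpha g x)].

Definition spectral alpha (s : dual R G) : set C :=
  [set c | forall g, alpha g c = s g *: c].

(* The algebraic direct sum of the spectral subspaces, inside [C]. *)
Definition spectral_sum alpha : set C :=
  [set c | exists l : seq (dual R G * C),
     (forall p, p \in l -> spectral alpha p.1 p.2) /\ c = \sum_(p <- l) p.2].

Definition is_invariant alpha (w : C -> R[i]) : Prop :=
  forall g x, w (alpha g x) = w x.

Definition invariant_states alpha : set (C -> R[i]) :=
  [set w | is_state w /\ is_invariant alpha w].

End Actions.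

(* Elements of the algebraic tensor product of the spectral subalgebras C_o and
   D_o are represented by formal finite sums of elementary tensors of
   homogeneous elements; ((s, c), (t, d)) stands for c (.) d with c of degree s
   and d of degree t (degrees are recorded since 0 has every degree).
   [prod_functional] and [eval_tensor] (for bilinear [m]) do not depend on the
   chosen representative. *)
Section Tensor.
Variables (R : realType) (G : topologicalZmodType) (C D : cstarType R).
Variable u : dual R G -> dual R G -> R[i].

Definition etensor := ((dual R G * C) * (dual R G * D))%type.

Definition homogeneous (alpha : G -> C -> C) (delta : G -> D -> D) :
    set (seq etensor) :=
  [set x : seq etensor | forall e : etensor, e \in x ->
     spectral alpha e.1.1 e.1.2 /\ spectral delta e.2.1 e.2.2].

Definition emul (e f : etensor) : etensor :=
  ((e.1.1 + f.1.1, (u f.1.1 e.2.1)^* *: (e.1.2 ** f.1.2)),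
   (e.2.1 + f.2.1, e.2.2 ** f.2.2)).

Definition estar (e : etensor) : etensor :=
  ((- e.1.1, (u e.1.1 e.2.1)^* *: star e.1.2), (- e.2.1, star e.2.2)).

Definition tmul (x y : seq etensor) : seq etensor :=
  [seq emul e f | e <- x, f <- y].

Definition tstar (x : seq etensor) : seq etensor := [seq estar e | e <- x].

Definition prod_functional (w : C -> R[i]) (p : D -> R[i]) (x : seq etensor) :
    R[i] := \sum_(e <- x) w e.1.2 * p e.2.2.

(* The seminorm <x, x> ^ (1/2) of the GNS inner product
   <x, y> = (w x p)(y^* x). *)
Definition gns_seminorm w p (x : seq etensor) : R :=
  Num.sqrt (complex.Re (prod_functional w p (tmul (tstar x) x))).

(* Operator norm of left multiplication by [x] in the GNS representation of
   w x p, computed on the dense image of the algebraic tensor product. *)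
Definition gns_opnorm alpha delta w p (x : seq etensor) : \bar R :=
  ereal_sup [set (gns_seminorm w p (tmul x y))%:E | y in
    homogeneous alpha delta `&` [set y | gns_seminorm w p y <= 1]].

Definition min_norm alpha delta (x : seq etensor) : \bar R :=
  ereal_sup [set gns_opnorm alpha delta wp.1 wp.2 x | wp in
    invariant_states alpha `*` invariant_states delta].

Definition eval_tensor (E : lmodType R[i]) (m : C -> D -> E)
  (x : seq etensor) : E := \sum_(e <- x) m e.1.2 e.2.2.

Definition bilinear_on (P : set C) (Q : set D) (E : lmodType R[i])
    (m : C -> D -> E) : Prop :=
  (forall k c c' d, P c -> P c' -> Q d ->
     m (k *: c + c') d = k *: m c d + m c' d) /\
  (forall k c d d', P c -> Q d -> Q d' ->
     m c (k *: d + d') = k *: m c d + m c d').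

(* [E], with the elementary tensors [m c d], is a C*-completion of the twisted
   algebraic tensor product for [min_norm].  The values of [m] outside
   C_o x D_o are irrelevant. *)
Definition is_twisted_tensor (alpha : G -> C -> C) (delta : G -> D -> D)
    (E : cstarType R) (m : C -> D -> E) : Prop :=
  [/\ bilinear_on (spectral_sum alpha) (spectral_sum delta) m,
      forall x y, homogeneous alpha delta x -> homogeneous alpha delta y ->
        eval_tensor m (tmul x y) = eval_tensor m x ** eval_tensor m y,
      forall x, homogeneous alpha delta x ->
        eval_tensor m (tstar x) = star (eval_tensor m x),
      dense [set eval_tensor m x | x in homogeneous alpha delta]
    & forall x, homogeneous alpha delta x ->
        (complex.Re `|eval_tensor m x|)%:E = min_norm alpha delta x].

Definition is_diagonal_action (alpha : G -> C -> C) (delta : G -> D -> D)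
    (E : cstarType R) (m : C -> D -> E) (a : G -> E -> E) : Prop :=
  forall g, [/\ is_starhom (a g), bijective (a g)
    & forall c d, spectral_sum alpha c -> spectral_sum delta d ->
        a g (m c d) = m (alpha g c) (delta g d)].

(* [m] is only meaningful on C_o x D_o, so the embedding of C into [E] is the
   extension by continuity of c |-> m c 1 from the dense subalgebra C_o. *)
Definition is_left_embedding (alpha : G -> C -> C)
    (E : cstarType R) (m : C -> D -> E) (i : C -> E) : Prop :=
  [/\ dense (spectral_sum alpha), is_starhom i, injective i, continuous i
    & forall c, spectral_sum alpha c -> i c = m c cone].

Definition is_product_state (alpha : G -> C -> C) (delta : G -> D -> D)
    (E : cstarType R) (m : C -> D -> E)
    (w : C -> R[i]) (p : D -> R[i]) (s : E -> R[i]) : Prop :=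
  is_state s /\ forall c d, spectral_sum alpha c -> spectral_sum delta d ->
    s (m c d) = w c * p d.

End Tensor.

Section InductiveLimit.
Variables (R : realType) (A : nat -> cstarType R).
Variable iota : forall n, A n -> A n.+1.

Fixpoint iterated_iota (n k : nat) : A n -> A (k + n) :=
  if k is k'.+1 then fun a => iota (iterated_iota k' a) else id.

(* The completion of the algebraic direct limit for the C*-seminorm
   a |-> lim_k `|iota_(n + k, n) a|. *)
Definition is_inductive_limit (L : cstarType R) (j : forall n, A n -> L) :
    Prop :=
  [/\ forall n, is_starhom (@j n),
      forall n a, j n.+1 (iota a) = j n a,
      dense [set x | exists n (a : A n), x = j n a]
    & forall n a, (fun k => complex.Re `|iterated_iota k a|) @ \oo
                    --> (complex.Re `|j n a| : R)].

End InductiveLimit.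

Definition cons_seq (R : realType) (B : cstarType R) (A : nat -> cstarType R)
  (n : nat) : cstarType R := if n is m.+1 then A m else B.

(* Main.v *)
(* Every unital *-homomorphism f of C*-algebras is contractive: for selfadjoint h
   with norm < 1, the element h + i (1 - h^2)^(1/2) is unitary, so f h is the real
   part of a unitary, and the C*-identity reduces the general case to this one.
   States are contractive by the same square root and Cauchy-Schwarz.  Hence
   identities between *-homomorphisms or states on a twisted tensor product need
   only be checked on elementary tensors, which makes every alpha^(n) an action
   intertwined by the embeddings, and every omega_n an invariant state restricting
   to omega_(n-1).  Since the norm of j_n a is the limit of the norms of the images
   of a, compatible families of contractive maps are bounded for the norm of the
   limit on the union of the j_n A_n, and extend from this dense set by continuity. *)
Require Import Defs.
From HB Require Import structures.
From mathcomp Require Import all_boot all_order all_algebra.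
From mathcomp Require Import complex.
From mathcomp Require Import ring.
From mathcomp Require Import all_classical all_reals all_analysis.

Import Order.TTheory GRing.Theory Num.Theory.
Import numFieldNormedType.Exports.

Local Open Scope classical_set_scope.
Local Open Scope ring_scope.
Local Open Scope complex_scope.

(** * Order, norm and completeness of the complex numbers *)

Lemma complex_ge0E (R : realType) (z : R[i]) : 0 <= z -> z = (complex.Re z)%:C.
Proof. by case: z => a b; rewrite lecE /= => /andP[/eqP -> _]. Qed.

Lemma complex_gt0E (R : realType) (z : R[i]) :
  0 < z -> 0 < complex.Re z /\ z = (complex.Re z)%:C.
Proof. by case: z => a b; rewrite ltcE /= => /andP[/eqP -> ->]. Qed.

Lemma normc_ge_Im (R : realType) (z : R[i]) : `|complex.Im z|%:C <= `|z|.
Proof.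
by rewrite normc_def lecR -sqrtr_sqr ler_wsqrtr// lerDr sqr_ge0.
Qed.

Lemma normc_le_ReIm (R : realType) (z : R[i]) :
  `|z| <= (`|complex.Re z| + `|complex.Im z|)%:C.
Proof.
rewrite normc_def lecR -[leRHS]ger0_norm ?addr_ge0// -sqrtr_sqr ler_wsqrtr//.
by rewrite sqrrD !real_normK ?num_real// addrAC lerDl mulrn_wge0 ?mulr_ge0.
Qed.

(** Real and imaginary parts are 1-Lipschitz, so they carry a Cauchy filter to Cauchy filters on
    [R]; the two limits recombine because the modulus is at most [|Re| + |Im|]. *)
Lemma complex_complete (R : realType) (F : set_system R[i]^o) :
  ProperFilter F -> cauchy F -> cvg F.
Proof.
move=> FF Fc.
have part (p : R[i]^o -> R) : (forall z w : R[i]^o, (`|p z - p w|)%:C <= `|z - w|) ->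
    cvg (p @ F).
  move=> pL; apply: cauchy_cvg; apply/cauchy_ballP => e e0.
  have /cauchy_ballP/(_ e%:C) := Fc; rewrite ltcR => /(_ e0).
  move=> [[P Q] /= [FP FQ] PQ]; exists (p @` P, p @` Q) => /=.
    by split; rewrite /nbhs /=; [apply: filterS FP|apply: filterS FQ] => z Pz; exists z.
  move=> [_ _] [/= [z Pz <-] [w Qw <-]].
  have := PQ (z, w) (conj Pz Qw); rewrite -ball_normE /= => zw.
  by rewrite -ball_normE /= -ltcR; apply: le_lt_trans zw.
have /cvg_ex[a Rea] : cvg ((fun z : R[i]^o => complex.Re z) @ F).
  by apply: part => z w; rewrite -raddfB normc_ge_Re.
have /cvg_ex[b Imb] : cvg ((fun z : R[i]^o => complex.Im z) @ F).
  by apply: part => z w; rewrite -raddfB normc_ge_Im.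
apply/cvg_ex; exists (a +i* b : R[i]^o); apply/cvgrPdist_lt => e /complex_gt0E[e0 ->].
near=> z; apply: le_lt_trans (normc_le_ReIm _ _) _.
rewrite ltcR [ltRHS]splitr !raddfB /= ltrD//.
  by near: z; move/cvgrPdist_lt: Rea; apply; rewrite divr_gt0.
by near: z; move/cvgrPdist_lt: Imb; apply; rewrite divr_gt0.
Unshelve. all: by end_near. Qed.

(** * Density, uniqueness and extension by continuity *)

Lemma eq_on_dense (T U : topologicalType) (S : set T) (f g : T -> U) :
  hausdorff_space U -> dense S -> continuous f -> continuous g ->
  (forall x, S x -> f x = g x) -> f =1 g.
Proof.
(* It suffices that any neighbourhoods [P] of [f x] and [Q] of [g x] meet: the intersection of their
   preimages has nonempty interior, hence contains a point of [S], where [f] and [g] agree. *)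
move=> hU dS cf cg fg x; apply: hU => P Q Pf Qg.
have /nbhs_interior : nbhs x (f @^-1` P `&` g @^-1` Q).
  by apply: filterI; [apply: cf|apply: cg].
move=> xPQ; have [||y [/interior_subset[/= Py Qy] Sy]] := dS (f @^-1` P `&` g @^-1` Q)^°.
- by exists x; exact: nbhs_singleton.
- exact: open_interior.
- by exists (f y); split => //; rewrite fg.
Qed.

(** Separate continuity suffices: for a first variable in [S1] equality spreads over the second, and
    then it spreads over the first. *)
Lemma eq_on_dense2 (T1 T2 U : topologicalType) (S1 : set T1) (S2 : set T2)
    (f g : T1 -> T2 -> U) :
  hausdorff_space U -> dense S1 -> dense S2 ->
  (forall y, continuous (f^~ y)) -> (forall y, continuous (g^~ y)) ->
  (forall x, continuous (f x)) -> (forall x, continuous (g x)) ->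
  (forall x y, S1 x -> S2 y -> f x y = g x y) -> f =2 g.
Proof.
move=> hU dS1 dS2 cf1 cg1 cf2 cg2 fg x y.
apply: (eq_on_dense T1 U S1 (f^~ y) (g^~ y)) => // a Sa.
by apply: (eq_on_dense T2 U S2 (f a) (g a)) => // b Sb; exact: fg.
Qed.

Lemma lipschitz1_continuous (K : numFieldType) (V W : normedModType K) (f : V -> W) :
  (forall x y, `|f x - f y| <= `|x - y|) -> continuous f.
Proof.
move=> fL x; apply/cvgrPdist_lt => e e0; near=> y.
apply: le_lt_trans (fL _ _) _; near: y.
exact: (cvgr_dist_lt (FF := nbhs_filter x)).
Unshelve. all: by end_near. Qed.

(* Completeness of [W] is a hypothesis, not a [completeNormedModType] structure:
   [R[i]^o] cannot receive the latter canonically, since the key [regular] is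
   already taken by the instance for real [R^o]. *)
Lemma dense_lipschitz1_extension (K : numFieldType) (V W : normedModType K)
    (D : Type) (p : D -> V) (q : D -> W) :
  (forall F : set_system W, ProperFilter F -> cauchy F -> cvg F) ->
  dense (range p) -> (forall a b, `|q a - q b| <= `|p a - p b|) ->
  exists f : V -> W,
    (forall a, f (p a) = q a) /\ (forall x y, `|f x - f y| <= `|x - y|).
Proof.
move=> Wc dp qL.
have near_p x (e : K) : 0 < e -> exists a, `|x - p a| < e.
  move=> e0; have [||y [ye [a _ pa]]] := dp (ball x e)^°.
  - by exists x; apply: nbhs_singleton; apply: nbhs_interior; exact: nbhsx_ballx.
  - exact: open_interior.
  - by exists a; rewrite pa; move: (interior_subset ye); rewrite -ball_normE.
(* The filter of parameters [a] along which [p a] tends to [x]; the extension at [x] is the limit of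
   [q] along it. *)
pose F x := filter_from [set e : K | 0 < e] (fun e => [set a | `|x - p a| < e]).
have FF x : ProperFilter (F x).
  apply: filter_from_proper => [|e e0]; last exact: near_p.
  apply: filter_from_filter; first by exists 1 => /=.
  move=> d e d0 e0 /=.
  (* The order of [K] is only partial, but positive elements are real and hence comparable. *)
  have [de|ed|ed] := real_ltgtP (gtr0_real d0) (gtr0_real e0).
  - by exists d => // a /= ad; split => //; exact: lt_trans ad de.
  - by exists e => // a /= ae; split => //; exact: lt_trans ae ed.
  - by exists d => // a /= ad; split => //; rewrite /= -ed.
have qF x : cvg (q @ F x).
  apply: Wc; apply/cauchy_exP => e e0.
  have [a xa] := near_p x _ (divr_gt0 e0 (ltr0n _ 2)).
  exists (q a), (e / 2) => [|b /= xb]; first by rewrite /= divr_gt0.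
  rewrite -ball_normE /=; apply: le_lt_trans (qL _ _) _.
  rewrite -(subrKA x) [ltRHS]splitr; apply: le_lt_trans (ler_normD _ _) _.
  by rewrite ltrD// distrC.
pose f x : W := lim (q @ F x).
have fE x e : 0 < e -> exists2 d, 0 < d & forall a, `|x - p a| < d -> `|f x - q a| < e.
  by move=> e0; have /cvgrPdist_lt/(_ _ e0)[d] := qF x; exists d.
exists f; split=> [a|x y].
  apply/eqP; rewrite -subr_eq0 -normr_le0; apply/ler_addgt0Pr => e e0.
  have [d d0 fd] := fE (p a) e e0.
  by rewrite add0r ltW// fd// subrr normr0.
apply/ler_addgt0Pr => e e0.
(* Four errors share [e]: from [x] to [p a], from [y] to [p b], from [f x] to [q a] and from [f y]
   to [q b]. *)
have e4 : 0 < e / 2 / 2 by rewrite !divr_gt0.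
have [c c0 fc] := fE x _ e4; have [d d0 fd] := fE y _ e4.
have pick z r : 0 < r -> exists2 a, `|z - p a| < r & `|z - p a| < e / 2 / 2.
  move=> r0.
  have [re|er] := real_leP (gtr0_real r0) (gtr0_real e4).
    by have [a za] := near_p z r r0; exists a => //; exact: lt_le_trans za re.
  by have [a za] := near_p z _ e4; exists a => //; exact: lt_trans za er.
have [a /fc fa xa] := pick x c c0; have [b /fd fb yb] := pick y d d0.
have qab : `|q a - q b| <= e / 2 / 2 + (`|x - y| + e / 2 / 2).
  apply: le_trans (qL _ _) _.
  have -> : p a - p b = (p a - x) + ((x - y) + (y - p b)) by rewrite !subrKA.
  apply: le_trans (ler_normD _ _) _; apply: lerD; first by rewrite distrC ltW.
  by apply: le_trans (ler_normD _ _) _; rewrite lerD2l ltW.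
have -> : f x - f y = (f x - q a) + ((q a - q b) + (q b - f y)) by rewrite !subrKA.
have -> : `|x - y| + e =
    e / 2 / 2 + ((e / 2 / 2 + (`|x - y| + e / 2 / 2)) + e / 2 / 2) by field.
apply: le_trans (ler_normD _ _) _; apply: lerD; first exact: ltW.
apply: le_trans (ler_normD _ _) _; apply: lerD => //.
by rewrite distrC ltW.
Qed.

(** * Norm, involution, product and square roots in a C*-algebra *)

Section CStarTheory.
Context {R : realType}.
Local Notation "x ** y" := (cmul x y) (at level 40, left associativity).

Lemma cmulBl (A : cstarType R) (x y z : A) : (x - y) ** z = x ** z - y ** z.
Proof. by rewrite cmulDl -(scaleN1r y) cmulZl scaleN1r. Qed.

Lemma cmulBr (A : cstarType R) (x y z : A) : x ** (y - z) = x ** y - x ** z.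
Proof. by rewrite cmulDr -(scaleN1r z) cmulZr scaleN1r. Qed.

Lemma starB (A : cstarType R) (x y : A) : star (x - y) = star x - star y.
Proof. by rewrite starD -(scaleN1r y) starZ rmorphN rmorph1 scaleN1r. Qed.

Lemma star_cone (A : cstarType R) : star cone = cone :> A.
Proof. by rewrite -[LHS]cmul1r -[X in _ ** X]starK -starM cmul1r starK. Qed.

(** The C*-identity and submultiplicativity give [|z|^2 <= |star z| * |z|]; cancel [|z|] and apply
    the result to [star x] as well. *)
Lemma norm_star (A : cstarType R) (x : A) : `|star x| = `|x|.
Proof.
have le z : `|z| <= `|star z| :> R[i].
  have [->|z0] := eqVneq z 0; first by rewrite normr0.
  have nz : 0 < `|z| by rewrite normr_gt0.
  by rewrite -(ler_pM2r nz) -expr2 -cstar_id cnormM.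
by apply/eqP; rewrite eq_le le -{2}[x]starK le.
Qed.

Lemma norm_cone (A : cstarType R) : `|cone : A| = 1.
Proof.
have n0 : `|cone : A| != 0 by rewrite normr_eq0 cone_neq0.
by apply: (mulfI n0); rewrite mulr1 -expr2 -cstar_id star_cone cmul1r.
Qed.

Lemma star_continuous (A : cstarType R) : continuous (star : A -> A).
Proof. by apply: lipschitz1_continuous => x y; rewrite -starB norm_star. Qed.

Lemma cvg_cmul (A : cstarType R) (T : Type) (F : set_system T) {FF : Filter F}
    (f g : T -> A) (a b : A) :
  f @ F --> a -> g @ F --> b -> (fun t => f t ** g t) @ F --> a ** b.
Proof.
move=> fa gb; apply/cvgrPdist_lt => e e0.
(* The summand [e] in the denominator forces [d < 1], and then [d * (|a| + |b| + d) < e]. *)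
pose d := e / (`|a| + `|b| + 1 + e).
have s0 : 0 < `|a| + `|b| + 1 + e by rewrite addr_gt0// ltr_wpDl ?addr_ge0.
have d0 : 0 < d by rewrite divr_gt0.
have d1 : d < 1 by rewrite ltr_pdivrMr// mul1r ltrDr ltr_wpDl ?addr_ge0.
near=> t.
have fad : `|a - f t| < d by near: t; exact: cvgr_dist_lt.
have gbd : `|b - g t| < d by near: t; exact: cvgr_dist_lt.
have -> : a ** b - f t ** g t =
    a ** (b - g t) + ((a - f t) ** b - (a - f t) ** (b - g t)).
  by rewrite -cmulBr subKr cmulBr cmulBl subrKA.
apply: (@le_lt_trans _ _ (`|a| * d + (d * `|b| + d * d))).
  apply: le_trans (ler_normD _ _) _; apply: lerD.
    by apply: le_trans (cnormM _ _) _; rewrite ler_wpM2l// ltW.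
  apply: le_trans (ler_normB _ _) _; apply: lerD.
    by apply: le_trans (cnormM _ _) _; rewrite ler_wpM2r// ltW.
  by apply: le_trans (cnormM _ _) _; rewrite ler_pM// ltW.
have -> : `|a| * d + (d * `|b| + d * d) = d * (`|a| + `|b| + d) by ring.
rewrite -[ltRHS](divfK (lt0r_neq0 s0) e) -/d ltr_pM2l// -[ltRHS]addrA ltrD2l.
by rewrite (lt_trans d1)// ltrDl.
Unshelve. all: by end_near. Qed.

Lemma cmul_continuousl (A : cstarType R) (y : A) : continuous (fun x : A => x ** y).
Proof. by move=> x; apply: cvg_cmul; [exact: cvg_id|exact: cvg_cst]. Qed.

Lemma cmul_continuousr (A : cstarType R) (x : A) : continuous (cmul x : A -> A).
Proof. by move=> y; apply: cvg_cmul; [exact: cvg_cst|exact: cvg_id]. Qed.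

(* The square root is [cone - z], where z is the fixed point of the contraction
   z |-> (k + z ** z) / 2 of the ball of radius [`|k|]. *)
Lemma cstar_sqrt (A : cstarType R) (k : A) : star k = k -> `|k| < 1 ->
  exists y : A, [/\ star y = y, y ** y = cone - k
    & forall h, h ** k = k ** h -> h ** y = y ** h].
Proof.
move=> ks k1; pose q := `|k|.
have q0 : 0 <= q by exact: normr_ge0.
(* A fixed point satisfies [z + z = k + z ** z], which says that [cone - z] squares to
   [cone - k]. *)
pose T (z : A) : A := 2^-1 *: (k + z ** z).
have i2 : 0 <= 2^-1 :> R[i] by rewrite invr_ge0.
pose z n := iter n T 0.
have zq n : `|z n| <= q.
  elim: n => [|n IH]; first by rewrite normr0.
  rewrite /= normrZ ger0_norm//.
  have -> : q = 2^-1 * (q + q) by field.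
  rewrite ler_wpM2l// (le_trans (ler_normD _ _))// lerD2l.
  rewrite (le_trans (cnormM _ _))// (le_trans (ler_pM _ _ IH IH))//.
  by rewrite ler_piMl// ltW.
have Tq x y : `|x| <= q -> `|y| <= q -> `|T x - T y| <= q * `|x - y|.
  move=> xq yq; rewrite -scalerBr opprD addrACA subrr add0r normrZ ger0_norm//.
  have -> : x ** x - y ** y = x ** (x - y) + (x - y) ** y.
    by rewrite cmulBr cmulBl subrKA.
  have -> : q * `|x - y| = 2^-1 * (q * `|x - y| + `|x - y| * q) by field.
  rewrite ler_wpM2l// (le_trans (ler_normD _ _))// lerD//.
    by rewrite (le_trans (cnormM _ _))// ler_wpM2r.
  by rewrite (le_trans (cnormM _ _))// ler_wpM2l.
(* The iteration starts at 0 and stays in the ball of radius [q], which gives the case [n = 0]; each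
   further application of [T] gains a factor [q]. *)
have zD n m : `|z n - z (n + m)%N| <= q ^+ n * q.
  elim: n => [|n IH]; first by rewrite expr0 mul1r sub0r normrN.
  by rewrite addSn exprS -mulrA (le_trans (Tq _ _ _ _))// ler_wpM2l.
have zc : cvg (z n @[n --> \oo]).
  apply: cauchy_cvg; apply/cauchy_exP => e /complex_gt0E[e0 eE].
  (* Nonnegative elements of [R[i]] are real, so the decay of [q ^+ n] is read off in [R]. *)
  have qE := complex_ge0E _ _ q0; set r := complex.Re q in qE.
  have r1 : `|r| < 1 by rewrite -ltcR ger0_norm -?lecR -qE.
  have /cvgrPdist_lt/(_ _ e0)[N _ rN] := cvg_expr r1.
  exists (z N), N => // n /= /subnKC <-; rewrite -ball_normE /= eE.
  rewrite (le_lt_trans (zD _ _))//.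
  have := rN N (leqnn N); rewrite sub0r normrN ger0_norm ?exprn_ge0 -?lecR -?qE//.
  rewrite -ltcR rmorphXn /= -qE; apply: le_lt_trans.
  by rewrite ler_piMr ?exprn_ge0// ltW.
move/cvg_ex: zc => [l zl].
have lE : l = T l.
  have zSl : z n.+1 @[n --> \oo] --> l by have := zl; rewrite -cvg_shiftS.
  have zSTl : z n.+1 @[n --> \oo] --> T l.
    by apply: cvgZr; apply: cvgD; [exact: cvg_cst|exact: cvg_cmul].
  exact: (cvg_unique (@norm_hausdorff _ A) zSl zSTl).
(* Self-adjointness, and below commutation with [h], hold for every iterate and pass to the
   limit. *)
have zs n : star (z n) = z n.
  elim: n => [|n IH].
    by rewrite /z /= -(subrr (0 : A)) starB !subrr.
  by rewrite /= starZ starD starM IH ks geC0_conj.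
have ls : star l = l.
  have zsl : star (z n) @[n --> \oo] --> star l.
    by apply: continuous_cvg => //; exact: star_continuous.
  rewrite (_ : (fun n => star (z n)) = z) in zsl; last exact/funext.
  exact: (cvg_unique (@norm_hausdorff _ A) zsl zl).
exists (cone - l); split.
- by rewrite starB star_cone ls.
- have l2 : l + l = k + l ** l.
    by rewrite {1 2}lE -mulr2n -scaler_nat scalerA mulfV ?scale1r// pnatr_eq0.
  have -> : k = l + l - l ** l by rewrite l2 addrK.
  by rewrite cmulBl cmul1l cmulBr cmul1r !opprB opprD -addrA [- l + _]addrCA.
- move=> h hk; rewrite cmulBl cmulBr cmul1l cmul1r; congr (_ - _).
  have hz n : h ** z n = z n ** h.
    elim: n => [|n IH]; first by rewrite /z /= -(subrr (0 : A)) cmulBl cmulBr !subrr.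
    rewrite /= cmulZl cmulZr cmulDl cmulDr hk -/(z n).
    by rewrite -cmulA -IH !cmulA IH.
  have hzl : h ** z n @[n --> \oo] --> h ** l by apply: cvg_cmul => //; exact: cvg_cst.
  have zhl : z n ** h @[n --> \oo] --> l ** h by apply: cvg_cmul => //; exact: cvg_cst.
  rewrite (_ : (fun n => z n ** h) = (fun n => h ** z n)) in zhl; last exact/funext.
  exact: (cvg_unique (@norm_hausdorff _ A) hzl zhl).
Qed.

End CStarTheory.

(** * Contractive maps: homomorphisms, states and orbits *)

Section Contractivity.
Context {R : realType}.
Local Notation "x ** y" := (cmul x y) (at level 40, left associativity).

(** Rescaling by a positive real moves a self-adjoint element into the open unit ball, where
    [cstar_sqrt] applies. *)
Lemma selfadjoint_gauge (A : cstarType R) (h : A) (r : R[i]) :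
  star h = h -> `|h| < r -> star (r^-1 *: h) = r^-1 *: h /\ `|r^-1 *: h| < 1.
Proof.
move=> hs hr; have r0 : 0 < r by exact: le_lt_trans hr.
have r0' : 0 <= r^-1 by rewrite invr_ge0 ltW.
split; first by rewrite starZ hs geC0_conj.
by rewrite normrZ ger0_norm// mulrC ltr_pdivrMr// mul1r.
Qed.

Lemma starhom_contractive (A B : cstarType R) (f : A -> B) :
  is_starhom f -> forall x, `|f x| <= `|x|.
Proof.
move=> [fl f1 fM fs].
have fB := GRing.zmod_morphism_linear fl; have fZ := GRing.scalable_linear fl.
have unit_ball h : star h = h -> `|h| < 1 -> `|f h| <= 1.
  move=> hs h1.
  have [||y [ys yy hy]] := @cstar_sqrt _ _ (h ** h).
  - by rewrite starM hs.
  - rewrite (le_lt_trans (cnormM _ _))// (le_lt_trans _ h1)//.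
    by rewrite ler_piMl// ltW.
  have {}hy := hy h (cmulA _ _ _).
  (* The image of [h + 'i *: y], where [h] and [y] commute and [h ** h + y ** y = cone]; hence
     [star U ** U = cone], and [f h] is the real part of [U]. *)
  pose U := f h + 'i *: f y.
  have Us : star U = f h - 'i *: f y.
    by rewrite starD starZ -!fs hs ys conjCi scaleNr.
  have UU : star U ** U = cone.
    rewrite Us /U cmulBl !cmulDr !cmulZl !cmulZr scalerA.
    rewrite -expr2 sqrCi scaleN1r.
    by rewrite opprD opprK addrA -!fM hy addrK yy fB f1 subrKC.
  have U1 : `|U| = 1.
    apply/eqP; rewrite -(@eqrXn2 _ 2)//.
    by rewrite -cstar_id UU norm_cone expr1n.
  have -> : f h = 2^-1 *: (U + star U).
    rewrite Us /U addrACA subrr addr0 -mulr2n -(scaler_nat _ (f h)).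
    by rewrite scalerA mulVf ?scale1r.
  rewrite normrZ ger0_norm ?invr_ge0//.
  rewrite ler_pdivrMl ?ltr0n// mulr1 (le_trans (ler_normD _ _))//.
  by rewrite norm_star U1.
have sa h : star h = h -> `|f h| <= `|h|.
  move=> hs; apply/ler_addgt0Pr => e e0.
  have r0 : 0 < `|h| + e by rewrite ltr_wpDl.
  have [|hs' h1] := selfadjoint_gauge A h (`|h| + e) hs; first by rewrite ltrDl.
  move: (unit_ball _ hs' h1).
  by rewrite fZ normrZ gtr0_norm ?invr_gt0// ler_pdivrMl// mulr1.
(* By the C*-identity the squared norms are those of the self-adjoint elements [f (star x ** x)] and
   [star x ** x]. *)
move=> x; rewrite -(@ler_pXn2r _ 2) ?nnegrE// -!cstar_id -fs -fM.
by apply: sa; rewrite starM starK.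
Qed.

Lemma starhom_continuous (A B : cstarType R) (f : A -> B) :
  is_starhom f -> continuous f.
Proof.
move=> fh; apply: lipschitz1_continuous => x y.
have [fl _ _ _] := fh.
by rewrite -(GRing.zmod_morphism_linear fl); exact: starhom_contractive.
Qed.

Section States.
Variables (A : cstarType R) (w : A -> R[i]).
Hypothesis wstate : is_state w.

Lemma stateB x y : w (x - y) = w x - w y.
Proof. by case: wstate => wl _ _; exact: (GRing.zmod_morphism_linear wl). Qed.

Lemma stateD x y : w (x + y) = w x + w y.
Proof. by case: wstate => wl _ _; rewrite -{1}[x]scale1r wl mul1r. Qed.

Lemma stateZ k x : w (k *: x) = k * w x.
Proof. by case: wstate => wl _ _; exact: (GRing.scalable_linear wl). Qed.

(** Positivity of the left side is exploited twice: [k = 1] and [k = 'i] show that [w] is hermitian,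
    and [k = - w x] yields the Cauchy-Schwarz inequality against the unit. *)
Let state_shift x k :
  w (star (x + k *: cone) ** (x + k *: cone)) =
  w (star x ** x) + k * w (star x) + k^*%R * w x + k * k^*%R.
Proof.
have [_ _ w1] := wstate.
rewrite starD starZ star_cone cmulDl !cmulDr !cmulZr !cmulZl !cmul1r !cmul1l.
by rewrite !stateD !stateZ w1 mulr1 !addrA.
Qed.

Lemma state_star x : w (star x) = (w x)^*%R.
Proof.
have [_ wp _] := wstate.
(* This combination is a real combination of nonnegative numbers, hence real. At [k = 1] it makes
   [w (star x) + w x] real, at [k = 'i] it makes [w (star x) - w x] imaginary. *)
have re k : (k * w (star x) + k^*%R * w x)^*%R = k * w (star x) + k^*%R * w x.
  have -> : k * w (star x) + k^*%R * w x =
      w (star (x + k *: cone) ** (x + k *: cone)) - w (star x ** x) - `|k| ^+ 2.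
    by rewrite state_shift normCK; ring.
  by rewrite !rmorphB /= !geC0_conj// exprn_ge0.
have := re 1; rewrite conjC1 !mul1r rmorphD /= => reD.
have := re 'i; rewrite conjCi !mulNr -!mulrBr rmorphM rmorphB /= conjCi mulNr -mulrN.
move=> /(mulfI (neq0Ci _)) imD.
have n2 : 2 != 0 :> R[i] by rewrite pnatr_eq0.
apply: (mulfI n2); rewrite !mulr_natl !mulr2n.
have -> : w (star x) + w (star x) = (w (star x) + w x) + (w (star x) - w x) by ring.
by rewrite -reD -imD; ring.
Qed.

Lemma state_contractive x : `|w x| <= `|x|.
Proof.
have [_ wp w1] := wstate.
have sa h : star h = h -> w h <= `|h|.
  move=> hs; apply/ler_addgt0Pr => e e0.
  have r0 : 0 < `|h| + e by rewrite ltr_wpDl.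
  have [|hs' h1] := selfadjoint_gauge A h (`|h| + e) hs; first by rewrite ltrDl.
  (* With [r = |h| + e], positivity of [w] on [y ** y = cone - r^-1 *: h] reads [w h <= r]. *)
  have [y [ys yy _]] := cstar_sqrt _ _ hs' h1.
  have := wp y; rewrite ys yy stateB w1 subr_ge0 stateZ.
  by rewrite ler_pdivrMl// mulr1.
rewrite -(@ler_pXn2r _ 2) ?nnegrE// -cstar_id normCK.
apply: le_trans (sa _ _); last by rewrite starM starK.
(* Cauchy-Schwarz: since [w cone = 1], what remains is [0 <= w (star x ** x) - |w x|^2]. *)
have := wp (x + - w x *: cone); rewrite state_shift state_star rmorphN /=.
by rewrite !mulNr mulrN opprK [(w x)^*%R * w x]mulrC subrK subr_ge0.
Qed.

Lemma state_continuous : continuous (w : A -> R[i]^o).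
Proof.
by apply: lipschitz1_continuous => x y; rewrite -stateB; exact: state_contractive.
Qed.

End States.

End Contractivity.

(** Moving [x] to a nearby point of [S] costs at most [e / 3] at both [g] and [h], as all [a g] are
    1-Lipschitz; continuity of the orbit of that point supplies the last third. *)
Lemma orbit_continuous_dense (K : numFieldType) (G : topologicalType)
    (V : normedModType K) (a : G -> V -> V) (S : set V) :
  (forall g x y, `|a g x - a g y| <= `|x - y|) -> dense S ->
  (forall y, S y -> continuous (a^~ y)) -> forall x, continuous (a^~ x).
Proof.
move=> aL dS cS x g; apply/cvgrPdist_lt => e e0.
have e3 : 0 < e / 3 by rewrite divr_gt0.
have [||y [/interior_subset xy Sy]] := dS (ball x (e / 3))^°.
- by exists x; apply: nbhs_singleton; apply: nbhs_interior; exact: nbhsx_ballx.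
- exact: open_interior.
move: xy; rewrite -ball_normE /= => xy.
near=> h.
have -> : a g x - a h x = (a g x - a g y) + ((a g y - a h y) + (a h y - a h x)).
  by rewrite !subrKA.
have -> : e = e / 3 + (e / 3 + e / 3) by field.
apply: le_lt_trans (ler_normD _ _) _; apply: ltrD.
  exact: le_lt_trans (aL _ _ _) xy.
apply: le_lt_trans (ler_normD _ _) _; apply: ltrD.
  by near: h; move/cvgrPdist_lt: (cS y Sy g); exact.
by apply: le_lt_trans (aL _ _ _) _; rewrite distrC.
Unshelve. all: by end_near. Qed.

(** * Spectral subspaces, twisted tensor products and diagonal actions *)

Section Tensors.
Context {R : realType} {G : topologicalZmodType}.

Lemma linear_fun0 (K : pzRingType) (V W : lmodType K) (f : V -> W) :
  linear f -> f 0 = 0.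
Proof. by move=> fl; rewrite -(subrr 0) (GRing.zmod_morphism_linear fl) subrr. Qed.

Lemma action_lipschitz (A : cstarType R) (alpha : G -> A -> A) :
  (forall g, is_starhom (alpha g)) ->
  forall g x y, `|alpha g x - alpha g y| <= `|x - y|.
Proof.
move=> ah g x y; have [al _ _ _] := ah g.
by rewrite -(GRing.zmod_morphism_linear al); exact: starhom_contractive.
Qed.

Lemma spectral_sub_sum (A : cstarType R) (alpha : G -> A -> A) s c :
  spectral alpha s c -> spectral_sum alpha c.
Proof.
move=> sc; exists [:: (s, c)]; split; last by rewrite big_seq1.
by move=> p; rewrite inE => /eqP ->.
Qed.

Lemma spectral_sum0 (A : cstarType R) (alpha : G -> A -> A) : spectral_sum alpha 0.
Proof. by exists [::]; split=> //; rewrite big_nil. Qed.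

Lemma spectral_sum_cone (A : cstarType R) (alpha : G -> A -> A) :
  is_cstar_action alpha -> spectral_sum alpha cone.
Proof.
move=> [ah _ _ _]; apply: (@spectral_sub_sum _ _ 0) => g /=.
by have [_ -> _ _] := ah g; rewrite scale1r.
Qed.

(** On a homogeneous element [alpha g] is multiplication by a scalar, so degrees are preserved. *)
Lemma spectral_sum_action (A : cstarType R) (alpha : G -> A -> A) g c :
  is_cstar_action alpha -> spectral_sum alpha c -> spectral_sum alpha (alpha g c).
Proof.
move=> [ah _ _ _] [l [ls ->]].
have aZ h := GRing.scalable_linear (let: And4 al _ _ _ := ah h in al).
exists [seq (p.1, alpha g p.2) | p <- l]; split.
  move=> _ /mapP[p pl ->] h /=; rewrite (ls p pl g) aZ (ls p pl h).
  by rewrite /= !scalerA mulrC.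
have [al _ _ _] := ah g.
rewrite big_map /=; elim: l {ls} => [|p l IH]; first by rewrite !big_nil linear_fun0.
by rewrite !big_cons -[p.2 in LHS]scale1r al scale1r IH.
Qed.

Section TwistedTensor.
Variables (C D E : cstarType R) (u : dual R G -> dual R G -> R[i]).
Variables (alpha : G -> C -> C) (delta : G -> D -> D) (m : C -> D -> E).
Hypothesis (tw : is_twisted_tensor u alpha delta m).

(** Evaluations of homogeneous formal sums are dense in [E], and linearity splits each of them into
    elementary tensors. *)
Lemma eq_on_tensors (V : normedModType R[i]) (f g : E -> V) :
  linear f -> linear g -> continuous f -> continuous g ->
  (forall c d, spectral_sum alpha c -> spectral_sum delta d ->
     f (m c d) = g (m c d)) -> f =1 g.
Proof.
move=> fl gl cf cg fg; have [_ _ _ dS _] := tw.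
apply: (eq_on_dense _ _ _ f g (@norm_hausdorff _ V) dS cf cg) => _ [x hx <-].
rewrite /eval_tensor; elim: x hx => [|e x IH] hx; first by rewrite !big_nil !linear_fun0.
have [ec ed] := hx e (mem_head e x).
rewrite big_cons -[m _ _]scale1r fl gl fg.
- by rewrite IH// => e' e'x; apply: hx; rewrite inE e'x orbT.
- exact: spectral_sub_sum ec.
- exact: spectral_sub_sum ed.
Qed.

(** Bilinearity is available only on the spectral sums and in the form [k *: c + c']; putting
    [c' = 0] calls for [m 0 d = 0], which follows from additivity at 0. *)
Lemma tensorZ k l c d : spectral_sum alpha c -> spectral_sum delta d ->
  spectral_sum delta (l *: d) -> m (k *: c) (l *: d) = (k * l) *: m c d.
Proof.
move=> Pc Qd Qld; have [[mL mR] _ _ _ _] := tw.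
have m0l d' : spectral_sum delta d' -> m 0 d' = 0.
  move=> Qd'; have P0 := spectral_sum0 C alpha.
  have := mL 1 0 0 d' P0 P0 Qd'; rewrite !scale1r addr0.
  by move=> /(congr1 (fun x => x - m 0 d')); rewrite subrr addrK.
have m0r : m c 0 = 0.
  have Q0 := spectral_sum0 D delta.
  have := mR 1 c 0 0 Pc Q0 Q0; rewrite !scale1r addr0.
  by move=> /(congr1 (fun x => x - m c 0)); rewrite subrr addrK.
rewrite -[k *: c]addr0 mL//; last exact: spectral_sum0.
rewrite m0l// addr0 -[l *: d]addr0 mR//; last exact: spectral_sum0.
by rewrite m0r addr0 scalerA.
Qed.

Hypotheses (alphaA : is_cstar_action alpha) (deltaA : is_cstar_action delta).

Section Diagonal.
Variable a : G -> E -> E.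
Hypothesis diag : is_diagonal_action alpha delta m a.

Let ah g : is_starhom (a g). Proof. by have [] := diag g. Qed.
Let al g : linear (a g). Proof. by have [] := ah g. Qed.
Let am g c d : spectral_sum alpha c -> spectral_sum delta d ->
  a g (m c d) = m (alpha g c) (delta g d).
Proof. by have [_ _] := diag g; exact. Qed.

Lemma diagonal_action : is_cstar_action a.
Proof.
have [_ alpha0 alphaD _] := alphaA; have [_ delta0 deltaD _] := deltaA.
have [_ _ _ dS _] := tw.
split=> //.
- apply: eq_on_tensors => //; first exact: starhom_continuous.
    by move=> x; exact: cvg_id.
  by move=> c d Pc Qd; rewrite am// alpha0 delta0.
- move=> g h; apply: eq_on_tensors => //.
  + by move=> k x y; rewrite !al.
  + exact: starhom_continuous.
  + move=> x; apply: (@continuous_comp _ _ _ (a h) (a g)); exact: starhom_continuous.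
  + move=> c d Pc Qd; rewrite !am//; first by rewrite alphaD deltaD.
      exact: spectral_sum_action.
    exact: spectral_sum_action.
(* Orbits are checked on evaluations of formal sums, by induction on the sum. *)
- apply: (orbit_continuous_dense _ _ _ _ _ (action_lipschitz _ _ ah) dS) => _ [x hx <-].
  rewrite /eval_tensor; elim: x hx => [|e x IH] hx.
    rewrite big_nil => g; rewrite (_ : a^~ 0 = fun=> 0); first exact: cvg_cst.
    by apply/funext => h; exact: linear_fun0.
  have [ec ed] := hx e (mem_head e x).
  have Pc := spectral_sub_sum _ _ _ _ ec; have Qd := spectral_sub_sum _ _ _ _ ed.
  rewrite big_cons => g.
  (* An elementary tensor of degrees [s] and [t] is multiplied by [s h * t h], which is continuous
     in [h] because characters are. *)
  rewrite (_ : a^~ _ = fun h => (e.1.1 h * e.2.1 h) *: m e.1.2 e.2.2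
      + a h (\sum_(e <- x) m e.1.2 e.2.2)).
    apply: cvgD; last first.
      by apply: IH => e' e'x; apply: hx; rewrite inE e'x orbT.
    apply: cvgZr_tmp; have [sc _ _] := char_ofP e.1.1; have [tc _ _] := char_ofP e.2.1.
    exact: cvgM (sc g) (tc g).
  apply/funext => h; rewrite -[m _ _ in LHS]scale1r al scale1r am// ec ed tensorZ//.
  by rewrite -ed; exact: spectral_sum_action.
Qed.

(** As [delta g] fixes the unit, both sides equal [m (alpha g c) cone] for [c] in the dense spectral
    sum. *)
Lemma left_embedding_equivariant (i : C -> E) : is_left_embedding alpha m i ->
  forall g c, a g (i c) = i (alpha g c).
Proof.
move=> [dC ih _ ci im] g; have [alphah _ _ _] := alphaA; have [deltah _ _ _] := deltaA.
apply: (eq_on_dense _ _ _ (a g \o i) (i \o alpha g) (@norm_hausdorff _ E) dC).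
- move=> c; apply: (@continuous_comp _ _ _ i (a g)); first exact: ci.
  exact: starhom_continuous.
- move=> c; apply: (@continuous_comp _ _ _ (alpha g) i); last exact: ci.
  exact: starhom_continuous.
- move=> c Pc /=; rewrite !im//; last exact: spectral_sum_action.
  have [_ d1 _ _] := deltah g.
  by rewrite am ?d1//; exact: spectral_sum_cone.
Qed.

Lemma product_state_invariant w p s : is_invariant alpha w -> is_invariant delta p ->
  is_product_state alpha delta m w p s -> is_invariant a s.
Proof.
move=> wi pi [ss sm] g x; have [sl _ _] := ss.
apply: (eq_on_tensors (R[i]^o) (s \o a g) s) => //.
- by move=> k y z /=; rewrite al sl.
- move=> y; apply: (@continuous_comp _ _ _ (a g) (s : E -> R[i]^o)).
    exact: starhom_continuous.
  exact: state_continuous.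
- exact: state_continuous.
- move=> c d Pc Qd /=; rewrite am// !sm ?wi ?pi//.
    exact: spectral_sum_action.
  exact: spectral_sum_action.
Qed.

End Diagonal.

(** On the dense spectral sum [i c] is [m c cone], where [s] takes the value [w c * p cone]. *)
Lemma product_state_restrict (i : C -> E) w p s :
  is_left_embedding alpha m i -> is_state w -> p cone = 1 ->
  is_product_state alpha delta m w p s -> forall c, s (i c) = w c.
Proof.
move=> [dC ih _ ci im] ws p1 [ss sm].
apply: (eq_on_dense _ R[i]^o _ (s \o i) w (@norm_hausdorff _ R[i]^o) dC).
- move=> c; apply: (@continuous_comp _ _ _ i (s : E -> R[i]^o)); first exact: ci.
  exact: state_continuous.
- exact: state_continuous.
- move=> c Pc /=; rewrite im// sm ?p1 ?mulr1//; exact: spectral_sum_cone.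
Qed.

End TwistedTensor.
End Tensors.

(** * Extension of compatible families to a C*-inductive limit *)

Section InductiveLimits.
Context {R : realType}.
Variables (A : nat -> cstarType R) (iota : forall n, A n -> A n.+1).
Variables (L : cstarType R) (j : forall n, A n -> L).
Arguments iota {n}.
Arguments j {n}.
Hypothesis lim_j : is_inductive_limit (@iota) (@j).

(** These are the maps out of the algebraic direct limit; both [j] and the families to be extended
    are of this kind. *)
Definition compatible (E : Type) (F : forall n, A n -> E) :=
  forall n (a : A n), F n.+1 (iota a) = F n a.

Lemma compatible_iterated (E : Type) (F : forall n, A n -> E) k n (a : A n) :
  compatible E F -> F (k + n)%N (iterated_iota (@iota) k a) = F n a.
Proof. by move=> cF; elim: k => [//|k IH] /=; rewrite cF. Qed.

(** The pair [a'], [b'] is chosen before [F], so that it serves [j] and the family being extended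
    simultaneously. *)
Lemma common_stage m n (a : A m) (b : A n) : exists N (a' b' : A N),
  forall (E : Type) (F : forall n, A n -> E), compatible E F ->
    F N a' = F m a /\ F N b' = F n b.
Proof.
have [/subnK mn|/ltnW/subnK nm] := leqP m n.
  (* With [n - m] generalised to [k], eliminating [k + m = n] places [b] in [A (k + m)] without a
     cast. *)
  move: (n - m)%N mn b => k; case: n / => b.
  exists (k + m)%N, (iterated_iota (@iota) k a), b => E F cF.
  by rewrite compatible_iterated.
move: (m - n)%N nm a => k; case: m / => a.
exists (k + n)%N, a, (iterated_iota (@iota) k b) => E F cF.
by rewrite compatible_iterated.
Qed.

Lemma j_compatible : compatible L (@j).
Proof. by case: lim_j. Qed.

(** By compatibility [F n a] is also the value of [F] at every later image of [a], so it is bounded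
    by the norms of these images, which converge to the norm of [j a]. *)
Lemma compatible_bound (E : normedModType R[i]) (F : forall n, A n -> E) :
  compatible E F -> (forall n a, `|F n a| <= `|a|) ->
  forall n (a : A n), `|F n a| <= `|j a|.
Proof.
move=> cF F1 n a; have [_ _ _ jn] := lim_j.
rewrite (complex_ge0E _ _ (normr_ge0 (F n a))) (complex_ge0E _ _ (normr_ge0 (j a))).
rewrite lecR -(cvg_lim _ (jn n a))//; apply: limr_ge.
  by apply/cvg_ex; exists (complex.Re `|j a|); exact: jn.
apply: nearW => k; rewrite -lecR -!complex_ge0E//.
by rewrite -(compatible_iterated E F k n a cF).
Qed.

(** Pairs of a stage and an element of it present the union of the images as a single range, the
    form used by [dense_lipschitz1_extension]. *)
Lemma dense_j : dense (range (fun p : {n & A n} => j (tagged p))).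
Proof.
have [_ _ dj _] := lim_j.
rewrite [X in dense X](_ : _ = [set x | exists n (a : A n), x = j a])//.
apply/seteqP; split=> [_ [[n a] _ <-]|_ [n [a ->]]]; first by exists n, a.
by exists (Tagged A a).
Qed.

(** Two elements are compared at a common stage, where [compatible_bound] applied to their
    difference gives the Lipschitz estimate. *)
Lemma limit_extension (E : normedModType R[i]) (F : forall n, A n -> E) :
  (forall X : set_system E, ProperFilter X -> cauchy X -> cvg X) ->
  compatible E F -> (forall n, {morph F n : a b / a - b}) ->
  (forall n a, `|F n a| <= `|a|) ->
  exists f : L -> E, (forall n (a : A n), f (j a) = F n a) /\
    (forall x y, `|f x - f y| <= `|x - y|).
Proof.
move=> Ec cF FB F1.
have [|f [fE fL]] := @dense_lipschitz1_extension _ L E _ _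
    (fun p : {n & A n} => F (tag p) (tagged p)) Ec dense_j.
  move=> [m a] [n b] /=; have [N [a' [b' ab]]] := common_stage m n a b.
  have [<- <-] := ab _ _ cF; have [<- <-] := ab _ _ j_compatible.
  have [jh _ _ _] := lim_j; have [jl _ _ _] := jh N.
  rewrite -FB -(GRing.zmod_morphism_linear jl).
  exact: compatible_bound.
by exists f; split=> // n a; exact: (fE (Tagged A a)).
Qed.

Lemma eq_on_limit (V : topologicalType) (f g : L -> V) :
  hausdorff_space V -> continuous f -> continuous g ->
  (forall n (a : A n), f (j a) = g (j a)) -> f =1 g.
Proof.
move=> hV cf cg fg; apply: (eq_on_dense _ _ _ f g hV dense_j cf cg).
by move=> _ [[n a] _ <-]; exact: fg.
Qed.

(** Any two elements of the dense union lie in one common stage, so binary identities are tested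
    inside a single [A n]. *)
Lemma eq_on_limit2 (V : topologicalType) (f g : L -> L -> V) :
  hausdorff_space V ->
  (forall y, continuous (f^~ y)) -> (forall y, continuous (g^~ y)) ->
  (forall x, continuous (f x)) -> (forall x, continuous (g x)) ->
  (forall n (a b : A n), f (j a) (j b) = g (j a) (j b)) -> f =2 g.
Proof.
move=> hV cf1 cg1 cf2 cg2 fg.
apply: (eq_on_dense2 _ _ _ _ _ f g hV dense_j dense_j cf1 cg1 cf2 cg2).
move=> _ _ [[m a] _ <-] [[n b] _ <-] /=; have [N [a' [b' ab]]] := common_stage m n a b.
by have [<- <-] := ab _ _ j_compatible; exact: fg.
Qed.

Lemma linear_on_limit (V : normedModType R[i]) (f : L -> V) :
  continuous f ->
  (forall n k (a b : A n), f (k *: j a + j b) = k *: f (j a) + f (j b)) -> linear f.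
Proof.
move=> cf fj k; apply: (eq_on_limit2 V (fun x y => f (k *: x + y)) (fun x y => k *: f x + f y)).
- exact: norm_hausdorff.
- move=> y x; apply: (@continuous_comp _ _ _ (fun x : L => k *: x + y) f); last exact: cf.
  by apply: cvgD; [apply: cvgZr; exact: cvg_id|exact: cvg_cst].
- move=> y x; apply: cvgD; [apply: cvgZr; exact: cf|exact: cvg_cst].
- move=> x y; apply: (@continuous_comp _ _ _ (fun y : L => k *: x + y) f); last exact: cf.
  by apply: cvgD; [exact: cvg_cst|exact: cvg_id].
- by move=> x y; apply: cvgD; [exact: cvg_cst|exact: cf].
- by move=> n a b; exact: fj.
Qed.

Lemma limit_starhom (f : L -> L) (F : forall n, A n -> A n) :
  (forall n, is_starhom (F n)) -> continuous f ->
  (forall n (a : A n), f (j a) = j (F n a)) -> is_starhom f.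
Proof.
move=> Fh cf fj; have [jh _ _ _] := lim_j.
split.
- apply: linear_on_limit => // n k a b.
  by have [jl _ _ _] := jh n; have [Fl _ _ _] := Fh n; rewrite -jl !fj Fl jl.
- have [_ j1 _ _] := jh 0%N; have [_ F1 _ _] := Fh 0%N.
  by rewrite -j1 fj F1.
- apply: (eq_on_limit2 L (fun x y => f (cmul x y)) (fun x y => cmul (f x) (f y))).
  + exact: norm_hausdorff.
  + move=> y x; apply: (@continuous_comp _ _ _ (fun x : L => cmul x y) f); last exact: cf.
    exact: cmul_continuousl.
  + by move=> y x; apply: cvg_cmul; [exact: cf|exact: cvg_cst].
  + move=> x y; apply: (@continuous_comp _ _ _ (cmul x) f); last exact: cf.
    exact: cmul_continuousr.
  + by move=> x y; apply: cvg_cmul; [exact: cvg_cst|exact: cf].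
  + move=> n a b; have [_ _ jM _] := jh n; have [_ _ FM _] := Fh n.
    by rewrite -jM !fj FM jM.
- apply: (eq_on_limit L); first exact: norm_hausdorff.
  + by move=> x; apply: (@continuous_comp _ _ _ star f); [exact: star_continuous|exact: cf].
  + by move=> x; apply: (@continuous_comp _ _ _ f star); [exact: cf|exact: star_continuous].
  + move=> n a; have [_ _ _ js] := jh n; have [_ _ _ Fs] := Fh n.
    by rewrite -js !fj Fs js.
Qed.

(** * The limit action and its invariant states *)

Section LimitAction.
Variables (G : topologicalZmodType) (alpha : forall n, G -> A n -> A n).
Hypothesis alphaA : forall n, is_cstar_action (alpha n).
Hypothesis alpha_iota : forall n g (a : A n),
  alpha n.+1 g (iota a) = iota (alpha n g a).

Lemma limit_action : exists2 alphaL : G -> L -> L, is_cstar_action alphaL &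
  forall g n (a : A n), alphaL g (j a) = j (alpha n g a).
Proof.
have [jh jc _ _] := lim_j.
have ah n g : is_starhom (alpha n g) by have [] := alphaA n.
(* The family extended is [j] after [alpha n g]: equivariance of the embeddings makes it compatible,
   and it is contractive as a composite of homomorphisms. *)
have ext g : exists f : L -> L, (forall n (a : A n), f (j a) = j (alpha n g a)) /\
    (forall x y, `|f x - f y| <= `|x - y|).
  apply: limit_extension.
  - by move=> X; exact: cauchy_cvg.
  - by move=> n a; rewrite alpha_iota jc.
  - move=> n a b; have [jl _ _ _] := jh n; have [al _ _ _] := ah n g.
    by rewrite (GRing.zmod_morphism_linear al) (GRing.zmod_morphism_linear jl).
  - move=> n a; apply: le_trans (starhom_contractive _ _ _ (jh n) _) _.
    exact: starhom_contractive.
have /choice[alphaL alphaLP] := ext.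
have aj g n (a : A n) : alphaL g (j a) = j (alpha n g a) by have [] := alphaLP g.
have aL g x y : `|alphaL g x - alphaL g y| <= `|x - y| by have [_] := alphaLP g; exact.
have ac g : continuous (alphaL g) by exact: lipschitz1_continuous.
exists alphaL => //; split.
- by move=> g; apply: (limit_starhom _ (fun n => alpha n g)).
- apply: (eq_on_limit L (alphaL 0) id) => //.
  by move=> x; exact: cvg_id.
  by move=> n a; rewrite aj; have [_ -> _ _] := alphaA n.
- move=> g h; apply: (eq_on_limit L (alphaL (g + h)) (alphaL g \o alphaL h)) => //.
    by move=> x; apply: (@continuous_comp _ _ _ (alphaL h) (alphaL g)); exact: ac.
  by move=> n a /=; rewrite !aj; have [_ _ -> _] := alphaA n.
(* On the dense union, an orbit is the image under the continuous [j] of an orbit in some [A n]. *)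
- apply: (orbit_continuous_dense _ _ _ _ _ aL dense_j) => _ [[n a] _ <-] /=.
  rewrite (_ : (fun g => alphaL g _) = fun g => j (alpha n g a)); last first.
    by apply/funext => g; rewrite aj.
  move=> g; apply: (@continuous_comp _ _ _ (fun g => alpha n g a) j).
    by have [_ _ _] := alphaA n; exact.
  exact: starhom_continuous.
Qed.

Lemma limit_action_unique (a b : G -> L -> L) :
  is_cstar_action a -> is_cstar_action b ->
  (forall g n (x : A n), a g (j x) = j (alpha n g x)) ->
  (forall g n (x : A n), b g (j x) = j (alpha n g x)) -> a = b.
Proof.
move=> [ah _ _ _] [bh _ _ _] aj bj; apply/funext => g; apply/funext.
apply: (eq_on_limit L); first exact: norm_hausdorff.
- exact: starhom_continuous.
- exact: starhom_continuous.
- by move=> n x; rewrite aj bj.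
Qed.

Variable omega : forall n, A n -> R[i].
Hypothesis omega_inv : forall n, invariant_states (alpha n) (omega n).
Hypothesis omega_iota : forall n (a : A n), omega n.+1 (iota a) = omega n a.

Lemma limit_invariant_state (alphaL : G -> L -> L) :
  is_cstar_action alphaL ->
  (forall g n (a : A n), alphaL g (j a) = j (alpha n g a)) ->
  exists! omegaL : L -> R[i], invariant_states alphaL omegaL /\
    forall n (a : A n), omegaL (j a) = omega n a.
Proof.
move=> [aLh _ _ _] aj; have [jh _ _ _] := lim_j.
have os n : is_state (omega n) by have [] := omega_inv n.
have [||| w [wj wL]] := limit_extension R[i]^o omega (@complex_complete R).
- exact: omega_iota.
- by move=> n a b; exact: stateB.
- by move=> n a; exact: state_contractive.
have wc : continuous (w : L -> R[i]^o) by apply: lipschitz1_continuous.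
exists w; split; last first.
  (* A competing state is contractive, hence continuous, hence determined on the dense union. *)
  move=> w' [[w's _] w'j]; apply/funext.
  apply: (eq_on_limit R[i]^o w w' _ wc (state_continuous _ _ w's)) => //.
  by move=> n a; rewrite wj w'j.
split=> //; split; last first.
  move=> g; have wac : continuous (w \o alphaL g : L -> R[i]^o).
    move=> x; apply: (@continuous_comp _ _ _ (alphaL g) (w : L -> R[i]^o)).
      exact: starhom_continuous.
    exact: wc.
  apply: (eq_on_limit R[i]^o _ _ (@norm_hausdorff _ R[i]^o) wac wc) => n a /=.
  by rewrite aj !wj; have [_ oi] := omega_inv n; exact: oi.
split.
- apply: (linear_on_limit R[i]^o _ wc) => n k a b.
  have [jl _ _ _] := jh n; rewrite -jl !wj.
  by have [ol _ _] := os n; rewrite ol.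
- pose q x : R[i]^o := w (cmul (star x) x).
  have qc : continuous q.
    move=> y; apply: (@continuous_comp _ _ _ (fun x => cmul (star x) x) (w : L -> R[i]^o)).
      by apply: cvg_cmul; [exact: star_continuous|exact: cvg_id].
    exact: wc.
  (* Positivity is rewritten as the equation [|q x| = q x] between continuous functions, which
     extends from the dense union. *)
  move=> x; rewrite ger0_def; apply/eqP.
  have nqc : continuous (fun x => `|q x| : R[i]^o).
    move=> y; apply: (@continuous_comp _ _ _ q (Num.norm : R[i]^o -> R[i]^o)).
      exact: qc.
    by apply: lipschitz1_continuous => z t; exact: ler_dist_dist.
  apply: (eq_on_limit R[i]^o _ _ (@norm_hausdorff _ R[i]^o) nqc qc) => n a /=.
  have [_ _ jM js] := jh n; rewrite /q -js -jM wj ger0_norm//.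
  by have [_ op _] := os n.
- have [_ j1 _ _] := jh 0%N; have [_ _ o1] := os 0%N.
  by rewrite -j1 wj.
Qed.

End LimitAction.
End InductiveLimits.

(** * The infinite twisted tensor power and its product states *)

Theorem theorem7p1 (R : realType)
  (G : topologicalZmodType)
  (Gcompact : compact [set: G]) (Ghausdorff : hausdorff_space G)
  (B : cstarType R) (beta : G -> B -> B) (beta_action : is_cstar_action beta)
  (u : dual R G -> dual R G -> R[i]) (u_bichar : is_bicharacter u)
  (A' : nat -> cstarType R)
  (A := cons_seq B A' : nat -> cstarType R)
  (tens : forall n, A n -> B -> A n.+1)
  (alpha : forall n, G -> A n -> A n)
  (iota : forall n, A n -> A n.+1)
  (alpha0 : alpha 0%N = beta)
  (A_twisted : forall n, is_twisted_tensor u (alpha n) beta (tens n))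
  (alphaS : forall n,
     is_diagonal_action (alpha n) beta (tens n) (alpha n.+1))
  (iotaE : forall n, is_left_embedding (alpha n) (tens n) (iota n))
  (L : cstarType R) (j : forall n, A n -> L)
  (L_limit : is_inductive_limit iota j) :
  exists alphaL : G -> L -> L,
    [/\ is_cstar_action alphaL,
        (forall g n a, alphaL g (j n a) = j n (alpha n g a)),
        (forall alphaL' : G -> L -> L, is_cstar_action alphaL' ->
           (forall g n a, alphaL' g (j n a) = j n (alpha n g a)) ->
           alphaL' = alphaL)
      & forall phi : nat -> B -> R[i],
          (forall n, invariant_states beta (phi n)) ->
          forall omega : forall n, A n -> R[i],
            omega 0%N = phi 0%N ->
            (forall n, is_product_state (alpha n) beta (tens n)
                         (omega n) (phi n.+1) (omega n.+1)) ->
            exists! omegaL : L -> R[i],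
              invariant_states alphaL omegaL /\
              forall n a, omegaL (j n a) = omega n a].
Proof.
(* Only [beta] is assumed to be an action; each later stage inherits the property from the previous
   one through the diagonal action. *)
have alphaA n : is_cstar_action (alpha n).
  elim: n => [|n IH]; first by rewrite alpha0.
  exact: diagonal_action (A_twisted n) IH beta_action _ (alphaS n).
have alpha_iota n g (a : A n) : alpha n.+1 g (iota n a) = iota n (alpha n g a).
  exact: left_embedding_equivariant (alphaA n) beta_action _ (alphaS n) _ (iotaE n) g a.
have [alphaL alphaLA alphaLj] := limit_action A iota L j L_limit G alpha alphaA alpha_iota.
exists alphaL; split=> //.
  move=> alphaL' alphaL'A alphaL'j.
  exact: (limit_action_unique A iota L j L_limit G alpha alphaL' alphaL).
move=> phi phi_inv omega omega0 omegaS.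
have omega_inv n : invariant_states (alpha n) (omega n).
  elim: n => [|n [ws wi]]; first by rewrite omega0 alpha0; exact: phi_inv.
  split; first by case: (omegaS n).
  have [_ phi_i] := phi_inv n.+1.
  exact: product_state_invariant (A_twisted n) (alphaA n) beta_action _ (alphaS n)
    _ _ _ wi phi_i (omegaS n).
(* The new factor [phi n.+1] is evaluated at the unit, where it equals 1. *)
have omega_iota n (a : A n) : omega n.+1 (iota n a) = omega n a.
  have [ws _] := omega_inv n; have [[_ _ phi1] _] := phi_inv n.+1.
  exact: product_state_restrict beta_action _ _ _ _ (iotaE n) ws phi1 (omegaS n) a.
exact: (limit_invariant_state A iota L j L_limit G alpha omega omega_inv omega_iota
  alphaL alphaLA alphaLj).
Qed.
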